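(* Let $(M,d)$ be a metric space and $Y\subseteq M$. Let $\mathcal{N}$ be a $\sigma$-algebra of subsets of $Y$ containing all Borel subsets of $Y$, and let $\nu$ be a measure on $\mathcal{N}$ with $\nu(Y)<+\infty$. Let $\upsilon_Y\in]0,+\infty[$ and assume that $Y$ is upper $\upsilon_Y$-Ahlfors regular with respect to $Y$. Let $s_1,s_2\in[0,\upsilon_Y[$; if $s_1+s_2=\upsilon_Y$, assume furthermore that $Y$ is strongly upper $\upsilon_Y$-Ahlfors regular with respect to $Y$. Let $K_1\in\mathcal{K}_{s_1,Y\times Y}$ and $K_2\in\mathcal{K}_{s_2,Y\times Y}$. Then: (i) If $s_1+s_2\geq\upsilon_Y$, then for each $(x,y)\in Y^2$ with $x\neq y$ the function $t\mapsto K_1(x,t)K_2(t,y)$ is $\nu$-integrable on $Y$, the function $K_3(x,y)\equiv\int_Y K_1(x,t)K_2(t,y)\,d\nu(t)$ is continuous on $\{(x,y)\in Y^2:x\neq y\}$, and \[ \sup_{x,y\in Y,\,x\neq y}|K_3(x,y)|\,d(x,y)^{s_1+s_2-\upsilon_Y}<+\infty \ \text{ if } s_1+s_2>\upsilon_Y,\qquad \sup_{x,y\in Y,\,x\neq y}|K_3(x,y)|\,(1+|\ln d(x,y)|)^{-1}<+\infty \ \text{ if } s_1+s_2=\upsilon_Y. \] (ii) If $s_1+s_2<\upsilon_Y$, then for each $(x,y)\in Y^2$ the function $t\mapsto K_1(x,t)K_2(t,y)$ is $\nu$-integrable on $Y$, the function $\tilde K_3(x,y)\equiv\int_Y K_1(x,t)K_2(t,y)\,d\nu(t)$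 is continuous on $Y^2$, and \[ \sup_{(x,y)\in Y^2}|\tilde K_3(x,y)|\,\bigl(1+d(x,y)^{\upsilon_Y-(s_1+s_2)}\bigr)^{-1}<+\infty. \]
   Context: For $\xi\in M$, $r>0$, $B(\xi,r)=\{\eta\in M: d(\xi,\eta)<r\}$, and $B(\xi,0)=\emptyset$. $Y$ is upper $\upsilon$-Ahlfors regular with respect to $Y$ if there exist $r_0\in]0,+\infty]$, $c_0\in]0,+\infty[$ with $\nu(B(x,r)\cap Y)\leq c_0r^{\upsilon}$ for all $x\in Y$, $r\in]0,r_0[$; strongly upper $\upsilon$-Ahlfors regular with respect to $Y$ if there exist $r_0\in]0,+\infty]$, $c_0\in]0,+\infty[$ with $\nu((B(x,r_2)\setminus B(x,r_1))\cap Y)\leq c_0(r_2^{\upsilon}-r_1^{\upsilon})$ for all $x\in Y$, $r_1,r_2\in[0,r_0[$, $r_1<r_2$. For $s\in\mathbb{R}$, $\mathcal{K}_{s,Y\times Y}$ is the set of continuous functions $K:\{(x,y)\in Y\times Y: x\neq y\}\to\mathbb{C}$ with $\sup_{x\neq y}|K(x,y)|\,d(x,y)^s<+\infty$. *)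

(* Defs.v *)
From HB Require Import structures.
From mathcomp Require Import all_boot all_order all_algebra.
From mathcomp Require Import all_classical all_reals all_analysis.
From mathcomp Require Import complex.
Set Implicit Arguments. Unset Strict Implicit. Unset Printing Implicit Defensive.
Import Order.TTheory GRing.Theory Num.Theory.
Local Open Scope classical_set_scope.
Local Open Scope ring_scope.

Section Defs.
Context {R : realType}.

Definition is_metric (T : Type) (d : T -> T -> R) : Prop :=
  [/\ forall x y, 0 <= d x y,
      forall x y, d x y = 0 <-> x = y,
      forall x y, d x y = d y x &
      forall x y z, d x z <= d x y + d y z].

(* open ball B(x,r) = {y | d(x,y) < r}  (empty for r = 0) *)
Definition dball (T : Type) (d : T -> T -> R) (x : T) (r : R) : set T :=
  [set y | d x y < r].

Definition dopen (T : Type) (d : T -> T -> R) (A : set T) : Prop :=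
  forall x, A x -> exists2 e : R, 0 < e & dball d x e `<=` A.

Definition cabs (z : R[i]) : R := Normc.normc z.

Definition continuous_offdiag (T : Type) (d : T -> T -> R) (K : T -> T -> R[i]) :=
  forall x y, x <> y -> forall e : R, 0 < e -> exists2 del : R, 0 < del &
    forall x' y', x' <> y' -> d x x' < del -> d y y' < del ->
      cabs (K x' y' - K x y) < e.

Definition continuous2 (T : Type) (d : T -> T -> R) (K : T -> T -> R[i]) :=
  forall x y, forall e : R, 0 < e -> exists2 del : R, 0 < del &
    forall x' y', d x x' < del -> d y y' < del ->
      cabs (K x' y' - K x y) < e.

(* the class K_{s, Y x Y} (K is only meaningful off the diagonal) *)
Definition kernel_class (T : Type) (d : T -> T -> R) (s : R) (K : T -> T -> R[i]) :=
  continuous_offdiag d K /\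
  exists C : R, forall x y, x <> y -> cabs (K x y) * (d x y) `^ s <= C.

Definition upper_ahlfors (dd : measure_display) (T : measurableType dd)
  (d : T -> T -> R) (nu : set T -> \bar R) (ups : R) : Prop :=
  exists r0 : \bar R, (0 < r0)%E /\ exists2 c0 : R, 0 < c0 &
    forall x r, 0 < r -> (r%:E < r0)%E ->
      (nu (dball d x r) <= (c0 * r `^ ups)%:E)%E.

Definition strong_upper_ahlfors (dd : measure_display) (T : measurableType dd)
  (d : T -> T -> R) (nu : set T -> \bar R) (ups : R) : Prop :=
  exists r0 : \bar R, (0 < r0)%E /\ exists2 c0 : R, 0 < c0 &
    forall x r1 r2, 0 <= r1 -> (r2%:E < r0)%E -> r1 < r2 ->
      (nu (dball d x r2 `\` dball d x r1) <= (c0 * (r2 `^ ups - r1 `^ ups))%:E)%E.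

Definition cintegrable (dd : measure_display) (T : measurableType dd)
  (mu : {measure set T -> \bar R}) (D : set T) (f : T -> R[i]) : Prop :=
  mu.-integrable D (fun t => (complex.Re (f t))%:E) /\
  mu.-integrable D (fun t => (complex.Im (f t))%:E).

Definition cintegral (dd : measure_display) (T : measurableType dd)
  (mu : {measure set T -> \bar R}) (D : set T) (f : T -> R[i]) : R[i] :=
  complex.Complex (Rintegral mu D (fun t => complex.Re (f t)))
                  (Rintegral mu D (fun t => complex.Im (f t))).

End Defs.

(* Main.v *)
Require Import Defs.
From HB Require Import structures.
From mathcomp Require Import all_boot all_order all_algebra.
From mathcomp Require Import all_classical all_reals all_analysis.
From mathcomp Require Import measurable_realfun complex ring lra.
Set Implicit Arguments. Unset Strict Implicit. Unset Printing Implicit Defensive.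
Import Order.TTheory GRing.Theory Num.Theory.
Import numFieldNormedType.Exports.
Local Open Scope classical_set_scope.
Local Open Scope ring_scope.

(** Since nu is finite, the upper Ahlfors bound holds, up to the constant, for
    all radii.  Cutting Y into dyadic shells around x and summing a geometric
    series bounds the integral of d(x,.)^-s by r^(ups-s) over B(x,r) if s < ups
    and over its complement if s > ups; a choice of exponent slightly above ups
    gives a logarithm when s = ups.  For the composition, put D = d(x,y) and
    s = s1+s2: on B(x,D/2) the second factor is at most (D/2)^-s2, symmetrically
    on B(y,D/2), and elsewhere a^-s1 b^-s2 <= a^-s + b^-s.  The same bounds show
    that small balls around the two poles contribute uniformly little, and
    dominated convergence on the rest yields continuity. *)

(** * Real and imaginary parts against the complex modulus *)

Section ComplexModulus.
Variable R : realType.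
Implicit Types z w : R[i].

Lemma ReB z w : complex.Re z - complex.Re w = complex.Re (z - w).
Proof. by case: z w => [a b] [a' b']. Qed.

Lemma ImB z w : complex.Im z - complex.Im w = complex.Im (z - w).
Proof. by case: z w => [a b] [a' b']. Qed.

Lemma ReM z w : complex.Re (z * w) =
  complex.Re z * complex.Re w - complex.Im z * complex.Im w.
Proof. by case: z w => [a b] [a' b']. Qed.

Lemma ImM z w : complex.Im (z * w) =
  complex.Re z * complex.Im w + complex.Im z * complex.Re w.
Proof. by case: z w => [a b] [a' b']. Qed.

Lemma Re_le_cabs z : `|complex.Re z| <= cabs z.
Proof.
case: z => a b; rewrite /cabs /Normc.normc /= -sqrtr_sqr ler_sqrt ?addr_ge0 ?sqr_ge0//.
by rewrite lerDl sqr_ge0.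
Qed.

Lemma Im_le_cabs z : `|complex.Im z| <= cabs z.
Proof.
case: z => a b; rewrite /cabs /Normc.normc /= -sqrtr_sqr ler_sqrt ?addr_ge0 ?sqr_ge0//.
by rewrite lerDr sqr_ge0.
Qed.

Lemma cabs_le_ReIm z : cabs z <= `|complex.Re z| + `|complex.Im z|.
Proof.
case: z => a b; rewrite /cabs /Normc.normc /=.
rewrite -[leRHS]ger0_norm ?addr_ge0// -sqrtr_sqr ler_sqrt ?sqr_ge0//.
rewrite sqrrD !real_normK ?num_real// addrAC lerDl.
by rewrite mulrn_wge0// mulr_ge0.
Qed.

End ComplexModulus.

(** * Real powers, geometric sums and dyadic localisation *)

Section PowerInequalities.
Variable R : realType.
Implicit Types a b s u : R.

Lemma le_powRN a b s : 0 <= s -> 0 < a -> a <= b -> b `^ (- s) <= a `^ (- s).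
Proof.
move=> s0 a0 ab; rewrite !powRN lef_pV2 ?posrE ?powR_gt0//; last first.
  exact: lt_le_trans ab.
by apply: ge0_ler_powR; rewrite ?nnegrE ?(ltW a0)// (le_trans (ltW a0)).
Qed.

Lemma powR_lt1 a u : 0 < a -> u * ln a < 0 -> a `^ u < 1.
Proof. by move=> a0 h; rewrite /powR gt_eqF// expR_lt1. Qed.

Lemma powR_expn a u k : 0 <= a -> (a ^+ k) `^ u = (a `^ u) ^+ k.
Proof.
move=> a0; elim: k => [|k IH]; first by rewrite !expr0 powR1.
by rewrite !exprS powRM ?exprn_ge0// IH.
Qed.

Lemma powR_small K u e : 0 < K -> 0 < u -> 0 < e ->
  exists2 r0, 0 < r0 & forall r, 0 <= r -> r <= r0 -> K * r `^ u <= e.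
Proof.
move=> K0 u0 e0; have eK0 : 0 < e / K by rewrite divr_gt0.
exists ((e / K) `^ u^-1); first exact: powR_gt0.
move=> r r_ge0 rr0; rewrite mulrC -ler_pdivlMr//.
apply: (@le_trans _ _ (((e / K) `^ u^-1) `^ u)).
  by apply: ge0_ler_powR; rewrite ?nnegrE ?powR_ge0// ltW.
by rewrite -powRrM mulVf ?gt_eqF// powRr1// ltW.
Qed.

(** The smaller of [a] and [b] has the larger negative powers, so putting it in place of the other
    base only increases the product. Zero bases, which occur when [t] sits at a pole, are checked by
    cases. *)
Lemma powRN_mul_le_sum a b s1 s2 : 0 <= a -> 0 <= b -> 0 <= s1 -> 0 <= s2 ->
  a `^ (- s1) * b `^ (- s2) <= a `^ (- (s1 + s2)) + b `^ (- (s1 + s2)).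
Proof.
move=> a0 b0 s10 s20.
have pD c : 0 < c -> c `^ (- (s1 + s2)) = c `^ (- s1) * c `^ (- s2).
  by move=> c0; rewrite opprD powRD// (gt_eqF c0) implybT.
have ge0 (c s : R) : 0 <= c `^ s := powR_ge0 c s.
(* By convention a power of zero is 1 for exponent 0 and 0 for every other exponent, negative ones
   included. *)
have zeroE s : 0 <= s -> 0 `^ (- s) = (s == 0)%:R :> R.
  by move=> s0; rewrite /powR eqxx oppr_eq0.
have sD0 : (s1 + s2 == 0) = (s1 == 0) && (s2 == 0) by rewrite paddr_eq0.
move: a0 b0; rewrite le_eqVlt => /predU1P[<-|a0];
  rewrite le_eqVlt => /predU1P[<-|b0].
- rewrite !zeroE// ?addr_ge0// sD0.
  by case: (s1 == 0); case: (s2 == 0);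
    rewrite ?mulr0 ?mul0r ?mulr1//= ?addr0 ?ler01// lerDl ler01.
- rewrite !zeroE// ?addr_ge0//.
  have [->|_] := eqVneq s1 0; last by rewrite mul0r addr_ge0.
  by rewrite add0r mul1r lerDr.
- rewrite [0 `^ (- s2)]zeroE// [0 `^ _]zeroE// ?addr_ge0//.
  have [->|_] := eqVneq s2 0; last by rewrite mulr0 addr_ge0.
  by rewrite addr0 mulr1 lerDl.
have [ab|/ltW ba] := leP a b.
- apply: (@le_trans _ _ (a `^ (- (s1 + s2)))); last by rewrite lerDl.
  by rewrite pD// ler_wpM2l// le_powRN.
- apply: (@le_trans _ _ (b `^ (- (s1 + s2)))); last by rewrite lerDr.
  by rewrite pD// ler_wpM2r// le_powRN.
Qed.

Lemma geometric_series_le (a z : R) n : 0 <= a -> 0 < z -> z < 1 ->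
  \sum_(0 <= k < n) a * z ^+ k <= a / (1 - z).
Proof.
move=> a0 z0 z1; have := @geometric_le_lim R n a z a0 z0.
by rewrite (ger0_norm (ltW z0)) => /(_ z1).
Qed.

(** Take the least power of two exceeding [u]; as [1 <= u], its exponent is positive and the
    preceding power works. *)
Lemma dyadic_lower u : 1 <= u -> exists k, 2 ^+ k <= u < 2 * 2 ^+ k.
Proof.
move=> u1; have /ex_minnP[k uk kmin] : exists k, u < 2 ^+ k.
  exists (Num.truncn u).+1; apply: (lt_trans (truncnS_gt u)).
  by rewrite -natrX ltr_nat ltn_expl.
case: k uk kmin => [|k] uk kmin; first by move: uk; rewrite expr0 ltNge u1.
exists k; rewrite -exprS uk andbT leNgt; apply/negP => /kmin.
by rewrite ltnn.
Qed.

(** Take the first power of one half not exceeding [u]. Minimality bounds [u] by the preceding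
    power; for exponent 0 the hypothesis [u < 2] supplies that bound. *)
Lemma dyadic_upper u : 0 < u -> u < 2 -> exists k, 2^-1 ^+ k <= u < 2 * 2^-1 ^+ k.
Proof.
move=> u0 u2; have /ex_minnP[k uk kmin] : exists k, 2^-1 ^+ k <= u.
  exists (Num.truncn u^-1).+1; rewrite exprVn invf_ple ?posrE ?exprn_gt0//.
  apply/ltW/(lt_trans (truncnS_gt u^-1)).
  by rewrite -natrX ltr_nat ltn_expl.
case: k uk kmin => [|k] uk kmin; first by exists 0%N; rewrite expr0 mulr1 u2 andbT.
exists k.+1; rewrite uk/= exprS mulrA divff ?pnatr_eq0// mul1r ltNge.
by apply/negP => /kmin; rewrite ltnn.
Qed.

End PowerInequalities.

(** * Subadditivity of nonnegative integrals in the domain *)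

Section IntegralSubadditivity.
Context {R : realType} {dd : measure_display} {T : measurableType dd}.
Variable mu : {measure set T -> \bar R}.
Local Open Scope ereal_scope.

Lemma ge0_le_integralU (A B : set T) (f : T -> \bar R) :
  measurable A -> measurable B -> measurable_fun setT f -> (forall t, 0 <= f t) ->
  \int[mu]_(t in A `|` B) f t <= \int[mu]_(t in A) f t + \int[mu]_(t in B) f t.
Proof.
move=> mA mB mf f0.
have -> : A `|` B = A `|` (B `\` A).
  by rewrite setDE setUIr setUv setIT.
have mBA : measurable (B `\` A) by exact: measurableD.
rewrite ge0_integral_setU//; last 2 first.
- exact: measurable_funTS.
- by apply/disj_setPS => t [? []].
by rewrite leeD2l// ge0_subset_integral//; exact: measurable_funTS.
Qed.

End IntegralSubadditivity.

(** * Measurability of balls, distances and functions continuous off two points *)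

Section MetricMeasure.
Context {R : realType} {dd : measure_display} {T : measurableType dd}.
Variables (d : T -> T -> R) (nu : {measure set T -> \bar R}).
Hypothesis d_metric : is_metric d.
Hypothesis borel : <<s [set A | dopen d A] >> `<=` measurable.

Let d_ge0 x y : 0 <= d x y. Proof. by case: d_metric. Qed.
Let d_eq0 x y : d x y = 0 <-> x = y. Proof. by case: d_metric => _ /(_ x y). Qed.
Let d_sym x y : d x y = d y x. Proof. by case: d_metric. Qed.
Let d_triangle x y z : d x z <= d x y + d y z. Proof. by case: d_metric. Qed.

Lemma dist_gt0 x y : x <> y -> 0 < d x y.
Proof. by move=> xy; rewrite lt0r d_ge0 andbT; apply/eqP => /d_eq0. Qed.

Lemma measurable_dopen (A : set T) : dopen d A -> measurable A.
Proof. by move=> oA; apply: borel; exact: sub_sigma_algebra. Qed.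

Lemma measurable_dball x r : measurable (dball d x r).
Proof.
apply: measurable_dopen => y /= xy; exists (r - d x y); first by rewrite subr_gt0.
by move=> t /= yt; apply: le_lt_trans (d_triangle x y t) _; rewrite -ltrBrDl.
Qed.

Lemma measurable_dist x : measurable_fun setT (d x).
Proof.
apply: (measurability _ (RGenInftyO.measurableE R)) => _ [_ [r ->] <-].
rewrite setTI (_ : _ @^-1` _ = dball d x r); first exact: measurable_dball.
by apply/seteqP; split => t /=; rewrite in_itv.
Qed.

Lemma measurable_dist1 (x : T) : measurable [set x].
Proof.
rewrite -[[set x]]setCK; apply: measurableC; apply: measurable_dopen.
move=> y /= yx; exists (d y x); first exact: dist_gt0.
by move=> t + tx; rewrite /dball/= tx ltxx.
Qed.

Lemma measurable_dist_powR s x : measurable_fun setT (fun t => (d x t) `^ s).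
Proof.
apply: (@measurableT_comp _ _ _ _ _ _ (fun u : R => u `^ s)).
  exact: measurable_powR.
exact: measurable_dist.
Qed.

(** Kernels are uncontrolled at their poles, so continuity is asked only off [x] and [y]: there the
    superlevel sets are open, and the two remaining points are measurable singletons. *)
Lemma measurable_off_pair (f : T -> R) (x y : T) :
  (forall t, t <> x -> t <> y -> forall e : R, 0 < e -> exists2 del : R, 0 < del &
     forall t', t' <> x -> t' <> y -> d t t' < del -> `|f t' - f t| < e) ->
  measurable_fun setT f.
Proof.
move=> fc.
have -> : [set: T] = ~` [set x; y] `|` ([set x] `|` [set y]) by rewrite setUC setUv.
have mx := measurable_dist1 x; have my := measurable_dist1 y.
have mxy := measurableU _ _ mx my.
have mCxy := measurableC mxy.
apply/measurable_funU => //.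
split; last first.
  by apply/measurable_funU => //; split; exact: measurable_fun_set1.
move=> mD; apply: (measurability _ (RGenOInfty.measurableE R)) => // _ [_ [r ->] <-].
apply: measurable_dopen => t [/= txy]; rewrite in_itv/= andbT => rft.
have [tx ty] : t <> x /\ t <> y by split => tE; apply: txy; [left|right].
have [del del0 Hdel] := fc t tx ty (f t - r) (ltac:(by rewrite subr_gt0)).
(* Capping the radius by the two distances makes the ball avoid [x] and [y]. *)
exists (Num.min del (Num.min (d t x) (d t y))).
  by rewrite !lt_min del0 !dist_gt0.
move=> t'; rewrite /dball/= !lt_min => /and3P[tt' tt'x tt'y].
have t'x : t' <> x by move=> t'E; move: tt'x; rewrite t'E ltxx.
have t'y : t' <> y by move=> t'E; move: tt'y; rewrite t'E ltxx.
split; first by move=> [].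
rewrite in_itv/= andbT; have := Hdel _ t'x t'y tt'.
by rewrite ltr_norml => /andP[+ _]; rewrite opprB ltrBlDr subrK.
Qed.

(** * One-pole integrals under a global upper Ahlfors bound *)

Section UpperRegular.
Variables (ups c : R).
Hypothesis ups_gt0 : 0 < ups.
Hypothesis c_gt0 : 0 < c.
Hypothesis nu_dball : forall x (r : R), 0 < r -> (nu (dball d x r) <= (c * r `^ ups)%:E)%E.

(** The point lies in balls of arbitrarily small measure. Consequently the values of kernels on the
    diagonal do not affect integrals. *)
Lemma measure_dist1 (x : T) : nu [set x] = 0%E.
Proof.
apply/eqP; rewrite eq_le measure_ge0 andbT; apply/lee_addgt0Pr => e e0; rewrite add0e.
(* This radius solves [c * r ^ ups = e]. *)
pose r : R := (e / c) `^ ups^-1.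
have ec0 : 0 < e / c by rewrite divr_gt0.
have r0 : 0 < r by rewrite powR_gt0.
apply: (@le_trans _ _ (nu (dball d x r))).
  apply: le_measure; rewrite ?inE; [exact: measurable_dist1|exact: measurable_dball|].
  by move=> _ ->; rewrite /dball/= (d_eq0 x x).2.
apply: (le_trans (nu_dball x r0)); rewrite lee_fin.
rewrite -powRrM mulVf ?gt_eqF// powRr1 ?(ltW ec0)//.
by rewrite mulrC divfK ?gt_eqF.
Qed.

(** On the [k]-th shell the integrand is at most the power at the inner radius, and the ball of
    twice that radius has measure controlled by [nu_dball]; the products form a geometric series of
    ratio [q ^ (ups - s)]. Keeping [q] free covers shells shrinking to [x] ([q = 1/2]) and shells
    growing to infinity ([q = 2]). *)
Lemma dyadic_integral_le q r s x (A : set T) : 0 < q -> 0 < r -> 0 <= s ->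
  q `^ (ups - s) < 1 -> measurable A ->
  (forall t, A t -> exists k, q ^+ k * r <= d x t < 2 * (q ^+ k * r)) ->
  (\int[nu]_(t in A) ((d x t) `^ (- s))%:E <=
   (c * 2 `^ ups * r `^ (ups - s) / (1 - q `^ (ups - s)))%:E)%E.
Proof.
move=> q0 r0 s0 z1 mA cover.
pose rk k := q ^+ k * r.
have rk0 k : 0 < rk k by rewrite mulr_gt0// exprn_gt0.
have rk2 k : 0 < 2 * rk k by rewrite mulr_gt0.
(* Whole balls replace the shells: a point of [A] only needs one term of the sum to dominate the
   integrand. *)
pose f k t : \bar R := ((rk k `^ (- s))%:E * (\1_(dball d x (2 * rk k)) t)%:E)%E.
have f0 k t : (0 <= f k t)%E by rewrite mule_ge0// lee_fin ?powR_ge0// indicE.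
have mf k : measurable_fun setT (f k).
  apply: measurable_funeM; apply/measurable_EFinP; apply: measurable_indic.
  exact: measurable_dball.
apply: (@le_trans _ _ (\int[nu]_(t in A) (\sum_(k <oo) f k t))%E).
  apply: ge0_le_integral => //.
  - by move=> t _; rewrite lee_fin powR_ge0.
  - apply: measurable_funTS; apply/measurable_EFinP; exact: measurable_dist_powR.
  - apply: measurable_funTS; apply: ge0_emeasurable_sum => //.
  - move=> t /cover[k /andP[rkd d2rk]].
    apply: (@le_trans _ _ (\sum_(0 <= i < k.+1) f i t)%E); last first.
      by apply: nneseries_lim_ge.
    rewrite big_nat_recr//= -[leLHS]add0e; apply: leeD; first exact: sume_ge0.
    by rewrite /f indicE mem_set// mule1 lee_fin le_powRN.
rewrite integral_nneseries//; last by move=> k; exact: measurable_funTS.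
set a := c * 2 `^ ups * r `^ (ups - s).
set z := q `^ (ups - s).
have intf k : (\int[nu]_(t in A) f k t <= (a * z ^+ k)%:E)%E.
  rewrite ge0_integralZl//; last 2 first.
  - apply: measurable_funTS; apply/measurable_EFinP; apply: measurable_indic.
    exact: measurable_dball.
  - by rewrite lee_fin powR_ge0.
  rewrite integral_indic//; last exact: measurable_dball.
  apply: (@le_trans _ _ ((rk k `^ (- s))%:E * (c * (2 * rk k) `^ ups)%:E)%E).
    rewrite lee_wpmul2l ?lee_fin ?powR_ge0//; apply: le_trans (nu_dball x (rk2 k)).
    apply: le_measure; rewrite ?inE//; last exact: measurable_dball.
    by apply: measurableI => //; exact: measurable_dball.
  have zE : (q ^+ k) `^ (ups - s) = z ^+ k by rewrite powR_expn// ltW.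
  have rkE : rk k `^ ups * rk k `^ (- s) = z ^+ k * r `^ (ups - s).
    by rewrite -powRD ?(gt_eqF (rk0 k)) ?implybT// powRM ?zE ?exprn_ge0 ?ltW.
  rewrite -EFinM lee_fin [(2 * rk k) `^ _]powRM ?ler0n ?(ltW (rk0 k))// le_eqVlt; apply/orP; left; apply/eqP.
  rewrite [LHS](_ : _ = c * 2 `^ ups * (rk k `^ ups * rk k `^ (- s))); last by ring.
  by rewrite rkE /a; ring.
apply: (@le_trans _ _ (\sum_(k <oo) (a * z ^+ k)%:E)%E).
  by apply: lee_nneseries => // k _ _; apply: integral_ge0.
have a0 : 0 <= a by rewrite !mulr_ge0 ?powR_ge0// ltW.
have z0 : 0 < z by rewrite powR_gt0.
apply: lime_le.
  by apply: is_cvg_nneseries => k _ _; rewrite lee_fin mulr_ge0// exprn_ge0// ltW.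
apply: nearW => n; rewrite sumEFin lee_fin.
exact: geometric_series_le.
Qed.

(** Shells shrink by one half, and the ratio is below 1 because [ups - s] is positive. *)
Lemma near_integral_le s : 0 <= s -> s < ups -> exists2 C : R, 0 < C &
  forall x r, 0 < r ->
    (\int[nu]_(t in dball d x r) ((d x t) `^ (- s))%:E <= (C * r `^ (ups - s))%:E)%E.
Proof.
move=> s0 sups; have z1 : (2^-1 : R) `^ (ups - s) < 1.
  apply: powR_lt1; rewrite ?invr_gt0// pmulr_rlt0 ?subr_gt0//.
  by rewrite lnV ?posrE// oppr_lt0 ln_gt0// ltr1n.
exists (c * 2 `^ ups / (1 - 2^-1 `^ (ups - s))).
  by rewrite divr_gt0 ?subr_gt0// mulr_gt0// powR_gt0.
move=> x r r0; set f := fun t => _.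
have f0 t : (0 <= f t)%E by rewrite lee_fin powR_ge0.
have mf : measurable_fun setT f.
  apply/measurable_EFinP; exact: measurable_dist_powR.
have mx := measurable_dist1 x.
have mB := measurable_dball x r.
have mBx : measurable (dball d x r `\` [set x]) by exact: measurableD.
(* No dyadic shell reaches the centre, which is split off as a null set. *)
have BE : dball d x r = dball d x r `\` [set x] `|` [set x].
  rewrite setDE setUIl setUC (setUC (~` _)) setUv setIT setUC.
  by apply/esym/setUidPl => _ ->; rewrite /dball/= (d_eq0 x x).2.
rewrite [X in integral _ X]BE.
apply: le_trans (ge0_le_integralU _ mBx mx mf f0) _.
rewrite [X in (_ + X)%E]null_set_integral ?adde0//; last 2 first.
- exact: measurable_funTS.
- exact: measure_dist1.
apply: le_trans (@dyadic_integral_le 2^-1 r s x _ _ r0 s0 z1 mBx _) _ => //.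
  move=> t [/= xt tx].
  have d0 : 0 < d x t by apply: dist_gt0 => xtE; exact: tx.
  have [||k /andP[k1 k2]] := @dyadic_upper R (d x t / r).
  - by rewrite divr_gt0.
  - by rewrite ltr_pdivrMr// (lt_le_trans xt)// ler_peMl ?ler1n// ltW.
  by exists k; rewrite -ler_pdivlMr// k1/= mulrA -ltr_pdivrMr.
by rewrite lee_fin mulrAC.
Qed.

(** Shells double in radius, and the ratio is below 1 because [ups - s] is negative. *)
Lemma far_integral_le s x r : ups < s -> 0 < r ->
  (\int[nu]_(t in ~` dball d x r) ((d x t) `^ (- s))%:E <=
   (c * 2 `^ ups * r `^ (ups - s) / (1 - 2 `^ (ups - s)))%:E)%E.
Proof.
move=> sups r0; apply: dyadic_integral_le => //.
- exact: le_trans (ltW ups_gt0) (ltW sups).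
- by apply: powR_lt1 => //; rewrite nmulr_rlt0 ?subr_lt0// ln_gt0// ltr1n.
- by apply: measurableC; exact: measurable_dball.
move=> t /= /negP; rewrite -leNgt => rd.
have [|k /andP[k1 k2]] := @dyadic_lower R (d x t / r).
  by rewrite ler_pdivlMr// mul1r.
by exists k; rewrite -ler_pdivlMr// k1/= mulrA -ltr_pdivrMr.
Qed.

Hypothesis nu_fin : (nu setT < +oo)%E.

Lemma measure_le_total (A : set T) : measurable A -> (nu A <= (fine (nu setT))%:E)%E.
Proof.
move=> mA; rewrite fineK ?ge0_fin_numE//.
by apply: le_measure; rewrite ?inE.
Qed.

Lemma total_ge0 : 0 <= fine (nu setT).
Proof. exact: fine_ge0. Qed.

(* On [d >= r] one has [d^-ups <= 1 + d^-(ups + delta)]; the choice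
   [delta = 1 / (1 + |ln r|)] keeps [r^-delta] bounded and makes the geometric
   constant [1 / (1 - 2^-delta)] grow like [|ln r|]. *)
Lemma far_integral_critical_le : exists2 C : R, 0 < C &
  forall x r, 0 < r ->
    (\int[nu]_(t in ~` dball d x r) ((d x t) `^ (- ups))%:E <=
     (C * (1 + `|ln r|))%:E)%E.
Proof.
have ln2 : 0 < ln (2 : R) by rewrite ln_gt0// ltr1n.
set a := c * 2 `^ ups; have a0 : 0 < a by rewrite mulr_gt0// powR_gt0.
have N0 := total_ge0; set N := fine _ in N0.
exists (a * expR 1 * (1 + (ln 2)^-1) + N).
  by rewrite ltr_wpDr// !mulr_gt0// ?expR_gt0// addr_gt0// invr_gt0.
move=> x r r0; set L := 1 + `|ln r|.
have L1 : 1 <= L by rewrite lerDl.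
have L0 : 0 < L by rewrite (lt_le_trans ltr01).
pose e := L^-1; have e0 : 0 < e by rewrite invr_gt0.
have mA : measurable (~` dball d x r) by apply: measurableC; exact: measurable_dball.
have mp s : measurable_fun (~` dball d x r) (fun t => ((d x t) `^ s)%:E).
  by apply: measurable_funTS; apply/measurable_EFinP; exact: measurable_dist_powR.
apply: (@le_trans _ _ (\int[nu]_(t in ~` dball d x r)
    (((d x t) `^ (- (ups + e)))%:E + cst 1%E t)))%E.
  apply: ge0_le_integral => //.
  - by move=> t _; rewrite lee_fin powR_ge0.
  - by apply: emeasurable_funD.
  - move=> t /= /negP; rewrite -leNgt => rd; rewrite -EFinD lee_fin.
    have dt0 : 0 < d x t := lt_le_trans r0 rd.
    have [d1|/ltW d1] := leP (d x t) 1.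
    + apply: (@le_trans _ _ ((d x t) `^ (- (ups + e)))); last by rewrite lerDl.
      by apply: ger_powR; rewrite ?dt0// lerN2 lerDl ltW.
    + apply: (@le_trans _ _ 1); last by rewrite lerDr powR_ge0.
      by rewrite -(powRr0 (d x t)) ler_powR// oppr_le0 ltW.
rewrite ge0_integralD//; last by move=> t _; rewrite lee_fin powR_ge0.
rewrite integral_cst// mul1e.
apply: le_trans (leeD (far_integral_le x _ r0) (measure_le_total mA)) _.
  by rewrite ltrDl.
have -> : ups - (ups + e) = - e by ring.
rewrite -EFinD lee_fin mulrDl lerD//; last by rewrite ler_peMr.
rewrite -/a; move: (a) a0 => {}a a0; rewrite -!mulrA ler_pM2l//.
have rE : r `^ (- e) <= expR 1.
  rewrite /powR gt_eqF// ler_expR mulNr -mulrN.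
  rewrite mulrC ler_pdivrMr// mul1r.
  by rewrite (le_trans (ler_norm _))// normrN lerDr.
apply: ler_pM => //; first exact: powR_ge0.
  rewrite invr_ge0 subr_ge0 ltW//; apply: powR_lt1 => //.
  by rewrite nmulr_rlt0// oppr_lt0.
have u0 : 0 < e * ln 2 by rewrite mulr_gt0.
have -> : 2 `^ (- e) = (expR (e * ln 2))^-1.
  by rewrite /powR gt_eqF// mulNr expRN.
(* With [u = e * ln 2], the inequality [1 + u <= exp u] gives [1 - exp (-u) >= u / (1 + u)], whose
   inverse is [1 + 1/u]; here [1/u] is [L / ln 2]. *)
have h := expR_ge1Dx (e * ln 2).
have E0 := expR_gt0 (e * ln 2); set E := expR _ in h E0 *.
have E1 : 0 < 1 - E^-1 by rewrite subr_gt0 invf_lt1// (lt_le_trans _ h)// ltrDl.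
apply: (@le_trans _ _ (1 + (e * ln 2)^-1)).
  rewrite -[leRHS]invrK lef_pV2 ?posrE//; last first.
    by rewrite invr_gt0 addr_gt0// invr_gt0.
  have -> : (1 + (e * ln 2)^-1)^-1 = 1 - (1 + e * ln 2)^-1.
    by field; rewrite ?gt_eqF ?addr_gt0.
  by rewrite lerB// lef_pV2// posrE addr_gt0.
rewrite invfM /e invrK; move: (L) L1 => l l1.
by rewrite mulrDl mul1r [(ln 2)^-1 * _]mulrC lerD2r.
Qed.

(** * Two-pole integrals: the model majorant of a product of kernels *)

Definition powerprod (s1 s2 : R) (x y t : T) : R :=
  (d x t) `^ (- s1) * (d y t) `^ (- s2).

Lemma powerprod_ge0 s1 s2 x y t : 0 <= powerprod s1 s2 x y t.
Proof. by rewrite mulr_ge0// powR_ge0. Qed.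

Lemma powerprodC s1 s2 x y : powerprod s1 s2 x y = powerprod s2 s1 y x.
Proof. by apply/funext => t; rewrite /powerprod mulrC. Qed.

Lemma measurable_powerprod s1 s2 x y : measurable_fun setT (powerprod s1 s2 x y).
Proof. by apply: measurable_funM; exact: measurable_dist_powR. Qed.

Lemma powerprod_le_sum s1 s2 x y t : 0 <= s1 -> 0 <= s2 ->
  powerprod s1 s2 x y t <= (d x t) `^ (- (s1 + s2)) + (d y t) `^ (- (s1 + s2)).
Proof. by move=> s10 s20; apply: powRN_mul_le_sum. Qed.

Let mdistE s x (A : set T) : measurable_fun A (fun t => ((d x t) `^ s)%:E).
Proof.
by apply: measurable_funTS; apply/measurable_EFinP; exact: measurable_dist_powR.
Qed.

Let mprodE s1 s2 x y (A : set T) :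
  measurable_fun A (fun t => (powerprod s1 s2 x y t)%:E).
Proof.
by apply: measurable_funTS; apply/measurable_EFinP; exact: measurable_powerprod.
Qed.

Let powE_ge0 s x t : (0 <= ((d x t) `^ s)%:E)%E.
Proof. by rewrite lee_fin powR_ge0. Qed.

Let prodE_ge0 s1 s2 x y t : (0 <= (powerprod s1 s2 x y t)%:E)%E.
Proof. by rewrite lee_fin powerprod_ge0. Qed.

Lemma integral_powerprod_le_sum s1 s2 x y (A : set T) : 0 <= s1 -> 0 <= s2 ->
  measurable A ->
  (\int[nu]_(t in A) (powerprod s1 s2 x y t)%:E <=
   \int[nu]_(t in A) ((d x t) `^ (- (s1 + s2)))%:E +
   \int[nu]_(t in A) ((d y t) `^ (- (s1 + s2)))%:E)%E.
Proof.
move=> s10 s20 mA; rewrite -ge0_integralD//.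
apply: ge0_le_integral => //; first exact: emeasurable_funD.
by move=> t _; rewrite -EFinD lee_fin powerprod_le_sum.
Qed.

(** At distance at least [e] from [y] the second factor is at most [e ^ (- s2)]; the first is
    integrated by [near_integral_le]. *)
Lemma near_powerprod_le s1 s2 : 0 <= s1 -> s1 < ups -> 0 <= s2 ->
  exists2 C : R, 0 < C & forall x y r e (A : set T), 0 < r -> 0 < e ->
    measurable A -> A `<=` dball d x r -> (forall t, A t -> e <= d y t) ->
    (\int[nu]_(t in A) (powerprod s1 s2 x y t)%:E <=
     (C * (r `^ (ups - s1) * e `^ (- s2)))%:E)%E.
Proof.
move=> s10 s1ups s20; have [C C0 HC] := near_integral_le s10 s1ups.
exists C => // x y r e A r0 e0 mA Ax Ay.
have eE : (0 <= (e `^ (- s2))%:E)%E by rewrite lee_fin powR_ge0.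
apply: (@le_trans _ _ (\int[nu]_(t in A)
    ((e `^ (- s2))%:E * ((d x t) `^ (- s1))%:E))%E).
  apply: ge0_le_integral => //; first exact: measurable_funeM.
  by move=> t /Ay ey; rewrite -EFinM lee_fin /powerprod mulrC ler_wpM2r ?powR_ge0// le_powRN.
rewrite ge0_integralZl// mulrA [C * _ * _]mulrC EFinM lee_wpmul2l//.
apply: le_trans (HC x r r0); apply: ge0_subset_integral => //.
exact: measurable_dball.
Qed.

(** The two half-distance balls contribute the same power of the distance. The far integrals stay
    unevaluated because the critical and supercritical cases estimate them differently. *)
Lemma integral_powerprod_split s1 s2 : 0 <= s1 -> s1 < ups -> 0 <= s2 -> s2 < ups ->
  exists2 C : R, 0 < C & forall x y, x <> y ->
    (\int[nu]_t (powerprod s1 s2 x y t)%:E <=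
     (C * (d x y / 2) `^ (ups - (s1 + s2)))%:E +
     (\int[nu]_(t in ~` dball d x (d x y / 2)) ((d x t) `^ (- (s1 + s2)))%:E +
      \int[nu]_(t in ~` dball d y (d x y / 2)) ((d y t) `^ (- (s1 + s2)))%:E))%E.
Proof.
move=> s10 s1ups s20 s2ups.
have [C1 C10 HC1] := near_powerprod_le s10 s1ups s20.
have [C2 C20 HC2] := near_powerprod_le s20 s2ups s10.
exists (C1 + C2); first by rewrite addr_gt0.
move=> x y xy; have D0 : 0 < d x y / 2 by rewrite divr_gt0// dist_gt0.
set D := d x y / 2 in D0 *.
have DD : d x y = D + D by rewrite /D; field.
set Bx := dball d x D; set By := dball d y D.
have mBx : measurable Bx by exact: measurable_dball.
have mBy : measurable By by exact: measurable_dball.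
have mB : measurable (Bx `|` By) by exact: measurableU.
have mF := measurableC mB.
rewrite -(setUv (Bx `|` By)).
apply: (le_trans (ge0_le_integralU nu mB mF (@mprodE s1 s2 x y setT) (prodE_ge0 s1 s2 x y))).
apply: leeD.
  apply: (le_trans (ge0_le_integralU nu mBx mBy (@mprodE s1 s2 x y setT) (prodE_ge0 s1 s2 x y))).
  have powD (s s' : R) : D `^ (ups - (s + s')) = D `^ (ups - s) * D `^ (- s').
    by rewrite -powRD ?(gt_eqF D0) ?implybT// opprD addrA.
  rewrite mulrDl EFinD; apply: leeD.
    rewrite powD; apply: HC1 => // t; rewrite /Bx /dball/= => xt.
    (* A point within half the distance of both poles would violate the triangle inequality. *)
    rewrite leNgt; apply/negP => yt; have := d_triangle x t y.
    by rewrite leNgt (d_sym t y) DD ltrD.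
  rewrite powerprodC [s1 + s2]addrC powD; apply: HC2 => // t; rewrite /By /dball/= => yt.
  rewrite leNgt; apply/negP => xt; have := d_triangle x t y.
  by rewrite leNgt (d_sym t y) DD ltrD.
apply: le_trans (integral_powerprod_le_sum x y s10 s20 mF) _.
(* Each one-pole term only needs to avoid its own ball, so its domain is enlarged. *)
apply: leeD; apply: ge0_subset_integral => //.
- exact: measurableC.
- by apply: subsetC; left.
- exact: measurableC.
- by apply: subsetC; right.
Qed.

Lemma integral_powerprod_super s1 s2 : 0 <= s1 -> s1 < ups -> 0 <= s2 -> s2 < ups ->
  ups < s1 + s2 ->
  exists C : R, forall x y, x <> y ->
    (\int[nu]_t (powerprod s1 s2 x y t)%:E <= (C * (d x y) `^ (ups - (s1 + s2)))%:E)%E.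
Proof.
move=> s10 s1ups s20 s2ups sups.
have [C C0 HC] := integral_powerprod_split s10 s1ups s20 s2ups.
set s := s1 + s2 in sups HC *; set u := ups - s.
pose K := c * 2 `^ ups / (1 - 2 `^ u).
(* [K] is the constant of [far_integral_le]; the last factor turns the power of half the distance
   into that of the distance. *)
exists ((C + (K + K)) * 2^-1 `^ u) => x y xy.
have D0 : 0 < d x y / 2 by rewrite divr_gt0// dist_gt0.
apply: (le_trans (HC x y xy)).
apply: le_trans (leeD (lexx _) (leeD (far_integral_le x sups D0) (far_integral_le y sups D0))) _.
rewrite -!EFinD lee_fin -/u -[leRHS]mulrA -powRM ?invr_ge0// [2^-1 * _]mulrC.
rewrite le_eqVlt; apply/orP; left; apply/eqP; rewrite /K.
by move: (_ `^ u) => v; ring.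
Qed.

Lemma integral_powerprod_critical s1 s2 : 0 <= s1 -> s1 < ups -> 0 <= s2 -> s2 < ups ->
  s1 + s2 = ups ->
  exists C : R, forall x y, x <> y ->
    (\int[nu]_t (powerprod s1 s2 x y t)%:E <= (C * (1 + `|ln (d x y)|))%:E)%E.
Proof.
move=> s10 s1ups s20 s2ups sups.
have [C C0 HC] := integral_powerprod_split s10 s1ups s20 s2ups.
(* At the critical exponent the near contribution scales with power 0, so it is a constant. *)
rewrite sups subrr in HC.
have [K K0 HK] := far_integral_critical_le.
(* The factor [1 + ln 2] absorbs the halving of the distance inside the logarithm. *)
exists (C + (K + K) * (1 + ln 2)) => x y xy.
have xy0 : 0 < d x y by exact: dist_gt0.
have D0 : 0 < d x y / 2 by rewrite divr_gt0.
apply: (le_trans (HC x y xy)).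
apply: le_trans (leeD (lexx _) (leeD (HK x _ D0) (HK y _ D0))) _.
rewrite -!EFinD lee_fin powRr0 mulr1 -mulrDl.
have l2 : 0 <= ln (2 : R) by rewrite ln_ge0// ler1n.
have lnD : `|ln (d x y / 2)| <= `|ln (d x y)| + ln 2.
  by rewrite ln_div ?posrE// (le_trans (ler_normB _ _))// (ger0_norm l2).
set l := `|ln (d x y)| in lnD *; have l0 : 0 <= l by exact: normr_ge0.
rewrite [leRHS]mulrDl lerD//; first by rewrite ler_peMr ?lerDl// ltW.
rewrite -mulrA ler_pM2l ?addr_gt0//.
apply: (@le_trans _ _ (1 + (l + ln 2))); first by rewrite lerD2l.
have := mulr_ge0 l2 l0; set k := ln 2; set p := k * l => p0.
have -> : (1 + k) * (1 + l) = 1 + (l + k) + p by rewrite /p; ring.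
by rewrite lerDl.
Qed.

(** Split at radius 1: inside, [near_integral_le] is uniform in [x]; outside, the integrand is at
    most 1 and the total mass is finite. *)
Lemma integral_dist_powRN_le s : 0 <= s -> s < ups ->
  exists C : R, forall x, (\int[nu]_t ((d x t) `^ (- s))%:E <= C%:E)%E.
Proof.
move=> s0 sups; have [C C0 HC] := near_integral_le s0 sups.
pose N := fine (nu setT); exists (C + N) => x.
have mB := measurable_dball x 1; have mCB := measurableC mB.
rewrite -(setUv (dball d x 1)).
apply: (le_trans (ge0_le_integralU nu mB mCB (@mdistE (- s) x setT) (powE_ge0 (- s) x))).
rewrite EFinD; apply: leeD.
  by apply: le_trans (HC x 1 ltr01) _; rewrite powR1 mulr1.
apply: le_trans (measure_le_total mCB); rewrite -[leRHS]mul1e -(integral_cst nu mCB).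
apply: ge0_le_integral => // t /= /negP; rewrite -leNgt => d1.
by rewrite lee_fin -(powRr0 (d x t)) ler_powR// oppr_le0.
Qed.

(** [powerprod_le_sum] decouples the poles and each term is integrable, so coinciding poles are
    allowed. *)
Lemma integral_powerprod_sub s1 s2 : 0 <= s1 -> 0 <= s2 -> s1 + s2 < ups ->
  exists C : R, forall x y, (\int[nu]_t (powerprod s1 s2 x y t)%:E <= C%:E)%E.
Proof.
move=> s10 s20 sups.
have [C HC] := integral_dist_powRN_le (addr_ge0 s10 s20) sups.
exists (C + C) => x y; rewrite EFinD.
by apply: le_trans (integral_powerprod_le_sum x y s10 s20 measurableT) _; exact: leeD.
Qed.

Lemma integral_powerprod_lty s1 s2 x y :
  0 <= s1 -> s1 < ups -> 0 <= s2 -> s2 < ups -> x <> y ->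
  (\int[nu]_t (powerprod s1 s2 x y t)%:E < +oo)%E.
Proof.
move=> s10 s1ups s20 s2ups xy.
have [slt|sgt|seq] := ltgtP (s1 + s2) ups.
- have [C HC] := integral_powerprod_sub s10 s20 slt.
  exact: le_lt_trans (HC x y) (ltry _).
- have [C HC] := integral_powerprod_super s10 s1ups s20 s2ups sgt.
  exact: le_lt_trans (HC x y xy) (ltry _).
- have [C HC] := integral_powerprod_critical s10 s1ups s20 s2ups seq.
  exact: le_lt_trans (HC x y xy) (ltry _).
Qed.

(** * Uniform smallness near the poles: a fixed neighbourhood, moving poles *)

Definition powerprod_small_near (s1 s2 : R) (x0 y0 : T) := forall e : R, 0 < e ->
  exists2 r : R, 0 < r & forall x y, d x0 x < r -> d y0 y < r ->
    (\int[nu]_(t in dball d x0 r `|` dball d y0 r) (powerprod s1 s2 x y t)%:E <= e%:E)%E.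

Let dball_shift x0 x r : d x0 x < r -> dball d x0 r `<=` dball d x (2 * r).
Proof.
move=> x0x t; rewrite /dball/= => x0t; apply: le_lt_trans (d_triangle x x0 t) _.
by rewrite (d_sym x x0) mulr_natl mulr2n ltrD.
Qed.

(** Near one pole the other stays at distance at least [D / 2], so [near_powerprod_le] leaves a
    positive power of the radius. *)
Lemma powerprod_small_offdiag s1 s2 x0 y0 :
  0 <= s1 -> s1 < ups -> 0 <= s2 -> s2 < ups -> x0 <> y0 ->
  powerprod_small_near s1 s2 x0 y0.
Proof.
move=> s10 s1ups s20 s2ups xy e e0.
have [C1 C10 HC1] := near_powerprod_le s10 s1ups s20.
have [C2 C20 HC2] := near_powerprod_le s20 s2ups s10.
have D0 := dist_gt0 xy; set D := d x0 y0 in D0.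
have D20 : 0 < D / 2 by rewrite divr_gt0.
have e20 : 0 < e / 2 by rewrite divr_gt0.
have [r1 r10 Hr1] := @powR_small R (C1 * (D / 2) `^ (- s2)) (ups - s1) (e / 2)
  (mulr_gt0 C10 (powR_gt0 _ D20)) (ltac:(by rewrite subr_gt0)) e20.
have [r2 r20 Hr2] := @powR_small R (C2 * (D / 2) `^ (- s1)) (ups - s2) (e / 2)
  (mulr_gt0 C20 (powR_gt0 _ D20)) (ltac:(by rewrite subr_gt0)) e20.
(* [D / 4] allows both the point and the opposite pole to move while keeping [D / 2] between them;
   [r1] and [r2] are halved since recentring a ball at the moved pole doubles its radius. *)
pose r := Num.min (D / 4) (Num.min (r1 / 2) (r2 / 2)).
have r0 : 0 < r by rewrite !lt_min !divr_gt0.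
have [rD rr1 rr2] : [/\ r <= D / 4, 2 * r <= r1 & 2 * r <= r2].
  split; first by rewrite ge_min lexx.
    by rewrite mulrC -ler_pdivlMr// !ge_min lexx orbT.
  by rewrite mulrC -ler_pdivlMr// !ge_min lexx !orbT.
have r20' : 0 < 2 * r by rewrite mulr_gt0.
exists r => // x y x0x y0y.
have mBx := measurable_dball x0 r; have mBy := measurable_dball y0 r.
apply: (le_trans (ge0_le_integralU nu mBx mBy (@mprodE s1 s2 x y setT)
  (prodE_ge0 s1 s2 x y))).
have -> : e = e / 2 + e / 2 by field.
rewrite EFinD; apply: leeD.
  apply: (le_trans (HC1 x y (2 * r) (D / 2) _ r20' D20 mBx (dball_shift x0x) _)).
    move=> t; rewrite /dball/= => x0t.
    have := d_triangle x0 t y0; have := d_triangle t y y0.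
    rewrite -/D (d_sym t y) (d_sym y y0) => h1 h2.
    by rewrite leNgt; apply/negP => h3; lra.
  by rewrite lee_fin [_ * (D / 2) `^ _]mulrC mulrA Hr1// ltW.
rewrite powerprodC.
apply: (le_trans (HC2 y x (2 * r) (D / 2) _ r20' D20 mBy (dball_shift y0y) _)).
  move=> t; rewrite /dball/= => y0t.
  have := d_triangle x0 t y0; have := d_triangle x0 x t.
  rewrite -/D (d_sym t y0) => h1 h2.
  by rewrite leNgt; apply/negP => h3; lra.
by rewrite lee_fin [_ * (D / 2) `^ _]mulrC mulrA Hr2// ltW.
Qed.

(** With no separation of the poles, the sum bound reduces to one-pole integrals of the subcritical
    exponent [s1 + s2]. *)
Lemma powerprod_small_diag s1 s2 x0 : 0 <= s1 -> 0 <= s2 -> s1 + s2 < ups ->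
  powerprod_small_near s1 s2 x0 x0.
Proof.
move=> s10 s20 sups e e0.
have [C C0 HC] := near_integral_le (addr_ge0 s10 s20) sups.
have e20 : 0 < e / 2 by rewrite divr_gt0.
have [r1 r10 Hr1] := @powR_small R C (ups - (s1 + s2)) (e / 2)
  C0 (ltac:(by rewrite subr_gt0)) e20.
have r0 : 0 < r1 / 2 by rewrite divr_gt0.
exists (r1 / 2) => // x y x0x x0y; rewrite setUid.
have mB := measurable_dball x0 (r1 / 2).
apply: (le_trans (integral_powerprod_le_sum x y s10 s20 mB)).
have -> : e = e / 2 + e / 2 by field.
have r1E : 2 * (r1 / 2) = r1 by field.
have bound z : d x0 z < r1 / 2 -> (\int[nu]_(t in dball d x0 (r1 / 2))
    ((d z t) `^ (- (s1 + s2)))%:E <= (e / 2)%:E)%E.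
  move=> x0z; apply: (@le_trans _ _ (\int[nu]_(t in dball d z r1)
      ((d z t) `^ (- (s1 + s2)))%:E)%E).
    apply: ge0_subset_integral => //; first exact: measurable_dball.
    by have := dball_shift x0z; rewrite r1E.
  by apply: le_trans (HC z r1 r10) _; rewrite lee_fin Hr1// ltW.
by rewrite EFinD leeD// bound.
Qed.

Lemma powerprod_small_sub s1 s2 x0 y0 :
  0 <= s1 -> s1 < ups -> 0 <= s2 -> s2 < ups -> s1 + s2 < ups ->
  powerprod_small_near s1 s2 x0 y0.
Proof.
move=> s10 s1ups s20 s2ups sups; have [->|xy] := pselect (x0 = y0).
  exact: powerprod_small_diag.
exact: powerprod_small_offdiag.
Qed.

(** Real counterpart of [kernel_class], satisfied by real and imaginary parts, with the bound solved
    for the kernel and a positive constant. *)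
Definition real_kernel (s : R) (k : T -> T -> R) :=
  (forall x y, x <> y -> forall e : R, 0 < e -> exists2 del : R, 0 < del &
    forall x' y', x' <> y' -> d x x' < del -> d y y' < del ->
      `|k x' y' - k x y| < e) /\
  exists2 C : R, 0 < C & forall x y, x <> y -> `|k x y| <= C * (d x y) `^ (- s).

(** * Composition of real kernels *)

Section RealKernels.
Variables (s1 s2 : R) (k1 k2 : T -> T -> R).
Hypothesis s1_ge0 : 0 <= s1.
Hypothesis s2_ge0 : 0 <= s2.
Hypothesis k1_kernel : real_kernel s1 k1.
Hypothesis k2_kernel : real_kernel s2 k2.

Let F x y t := k1 x t * k2 t y.

Lemma product_continuous x y t : t <> x -> t <> y -> forall e : R, 0 < e ->
  exists2 del : R, 0 < del & forall x' y' t', d x x' < del -> d y y' < del ->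
    d t t' < del -> `|F x' y' t' - F x y t| < e.
Proof.
move=> tx ty e e0.
pose a := k1 x t; pose b := k2 t y; pose m := 1 + `|a| + `|b|.
have m0 : 0 < m by rewrite /m -addrA ltr_pwDl// addr_ge0.
(* Expanding [a' b' - a b] around [a] and [b] leaves three terms, at most [h] (as [h <= 1]), [h |a|]
   and [h |b|]; their sum is [h * m <= e]. *)
pose h := Num.min 1 (e / m).
have h0 : 0 < h by rewrite lt_min ltr01 divr_gt0.
have [h1 hm] : h <= 1 /\ h * m <= e.
  by rewrite -ler_pdivlMr// !ge_min !lexx orbT.
have xt : x <> t by move=> /esym.
have [d1 d10 H1] := k1_kernel.1 x t xt h h0.
have [d2 d20 H2] := k2_kernel.1 t y ty h h0.
have dx0 := dist_gt0 tx; have dy0 := dist_gt0 ty.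
(* The half-distances keep [t'] apart from [x'] and [y'], where the continuity of the kernels is
   available. *)
exists (Num.min (Num.min d1 d2) (Num.min (d t x / 2) (d t y / 2))).
  by rewrite !lt_min d10 d20 !divr_gt0.
move=> x' y' t'; rewrite !lt_min.
move=> /andP[/andP[xx1 xx2] /andP[xx3 xx4]] /andP[/andP[yy1 yy2] /andP[yy3 yy4]].
move=> /andP[/andP[tt1 tt2] /andP[tt3 tt4]].
have x't' : x' <> t'.
  move=> E; have := d_triangle t t' x; rewrite -E (d_sym x' x) in tt3 *.
  by rewrite leNgt [ltRHS]splitr ltrD.
have t'y' : t' <> y'.
  move=> E; have := d_triangle t t' y; rewrite E (d_sym y' y) in tt4 *.
  by rewrite leNgt [ltRHS]splitr ltrD.
have := H1 _ _ x't' xx1 tt1; have := H2 _ _ t'y' tt2 yy2.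
rewrite -/a -/b /F; set a' := k1 x' t'; set b' := k2 t' y' => Hb Ha.
have -> : a' * b' - k1 x t * k2 t y = (a' - a) * (b' - b) + a * (b' - b) + (a' - a) * b.
  by rewrite /a /b; ring.
apply: lt_le_trans hm; have -> : h * m = h + h * `|a| + h * `|b| by rewrite /m; ring.
apply: (@le_lt_trans _ _ (`|(a' - a) * (b' - b)| + `|a * (b' - b)| + `|(a' - a) * b|)).
  by apply: le_trans (ler_normD _ _) _; rewrite lerD2r ler_normD.
rewrite !normrM.
have na := normr_ge0 a; have nb := normr_ge0 b.
have nda := normr_ge0 (a' - a); have ndb := normr_ge0 (b' - b).
apply: ltr_leD; last by rewrite ler_wpM2r// ltW.
apply: ltr_leD; last by rewrite mulrC ler_wpM2r// ltW.
apply: (@le_lt_trans _ _ (`|a' - a| * 1)); last by rewrite mulr1.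
by rewrite ler_wpM2l// ltW// (lt_le_trans Hb).
Qed.

Lemma measurable_product x y : measurable_fun setT (F x y).
Proof.
apply: (measurable_off_pair (x := x) (y := y)) => t tx ty e e0.
have [del del0 H] := product_continuous tx ty e0.
exists del => // t' _ _ tt'.
by apply: H => //; rewrite (d_eq0 _ _).2.
Qed.

Lemma product_bound : exists2 C : R, 0 < C & forall x y t, t <> x -> t <> y ->
  `|F x y t| <= C * powerprod s1 s2 x y t.
Proof.
have [C1 C10 H1] := k1_kernel.2; have [C2 C20 H2] := k2_kernel.2.
exists (C1 * C2); first exact: mulr_gt0.
move=> x y t tx ty; rewrite normrM /powerprod mulrACA (d_sym y t).
by apply: ler_pM => //; [apply: H1 => /esym|apply: H2].
Qed.

Let mFE x y (A : set T) : measurable_fun A (fun t => (`|F x y t|)%:E).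
Proof.
apply: measurable_funTS; apply/measurable_EFinP; apply: measurableT_comp => //.
exact: measurable_product.
Qed.

(** The pointwise bound can fail only at the two poles, a null set, so an almost everywhere
    comparison suffices. *)
Lemma integral_product_le : exists2 C : R, 0 < C & forall x y (A : set T),
  measurable A -> (\int[nu]_(t in A) (`|F x y t|)%:E <=
    C%:E * \int[nu]_(t in A) (powerprod s1 s2 x y t)%:E)%E.
Proof.
have [C C0 HC] := product_bound; exists C => // x y A mA.
have CE : (0 <= C%:E)%E by rewrite lee_fin ltW.
rewrite -ge0_integralZl//.
apply: ae_ge0_le_integral => //.
- by move=> t _; rewrite mule_ge0.
- exact: measurable_funeM.
have mx := measurable_dist1 x; have my := measurable_dist1 y.
exists [set x; y]; split; first exact: measurableU.
  by rewrite measureU0// measure_dist1.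
apply: subsetCl => t /= txy tA; rewrite -EFinM lee_fin HC//.
- by move=> tx; apply: txy; left.
- by move=> ty; apply: txy; right.
Qed.

Lemma integrable_product x y :
  (\int[nu]_t (powerprod s1 s2 x y t)%:E < +oo)%E ->
  nu.-integrable setT (fun t => (F x y t)%:E).
Proof.
move=> fin; apply/integrableP; split.
  by apply/measurable_EFinP; exact: measurable_product.
have [C C0 HC] := integral_product_le.
apply: le_lt_trans (HC x y setT measurableT) _.
rewrite lte_mul_pinfty// ?lee_fin; first exact: ltW.
Qed.

Lemma Rintegral_product_le : exists2 C : R, 0 < C & forall x y B,
  (\int[nu]_t (powerprod s1 s2 x y t)%:E <= B%:E)%E ->
  `|Rintegral nu setT (F x y)| <= C * B.
Proof.
have [C C0 HC] := integral_product_le; exists C => // x y B HB.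
have iF : nu.-integrable setT (EFin \o F x y).
  by apply: integrable_product; apply: le_lt_trans HB (ltry _).
rewrite -lee_fin EFin_normr_Rintegral//.
apply: le_trans (le_abse_integral nu measurableT _) _.
  by apply/measurable_EFinP; exact: measurable_product.
apply: le_trans (HC x y setT measurableT) _.
by rewrite EFinM lee_wpmul2l// lee_fin ltW.
Qed.

(* Off the fixed neighbourhood [A] of the two poles the products are bounded and
   converge pointwise, while their integrals over [A] are uniformly small. *)
Lemma Rintegral_product_continuous x0 y0 r0 : 0 < r0 ->
  (forall x y, d x0 x < r0 -> d y0 y < r0 ->
    (\int[nu]_t (powerprod s1 s2 x y t)%:E < +oo)%E) ->
  powerprod_small_near s1 s2 x0 y0 ->
  forall e : R, 0 < e -> exists2 del : R, 0 < del & forall x y,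
    d x0 x < del -> d y0 y < del ->
    `|Rintegral nu setT (F x y) - Rintegral nu setT (F x0 y0)| < e.
Proof.
move=> r00 fin small e e0; apply: contrapT => noc.
(* Arguing by contradiction yields a sequence of pairs tending to [(x0, y0)], to which dominated
   convergence applies. *)
have bad (del : R) : 0 < del -> exists p : T * T,
    [/\ d x0 p.1 < del, d y0 p.2 < del &
    e <= `|Rintegral nu setT (F p.1 p.2) - Rintegral nu setT (F x0 y0)|].
  move=> del0; apply: contrapT => nop; apply: noc; exists del => // x y xx yy.
  by rewrite ltNge; apply/negP => le; apply: nop; exists (x, y).
have [C C0 HC] := integral_product_le.
have [C' C'0 HC'] := product_bound.
(* After multiplication by [C], each of the two integrals over [A] is at most [e / 4]. *)
have eC0 : 0 < e / (4 * C) by rewrite divr_gt0// mulr_gt0.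
have [r r_gt0 Hr] := small _ eC0.
(* The three caps keep the poles at distance [r / 2] from the complement of [A], keep the integrals
   finite, and force convergence. *)
pose del n : R := Num.min (Num.min (r / 2) r0) n.+1%:R^-1.
have del0 n : 0 < del n by rewrite !lt_min divr_gt0// r00 invr_gt0 ltr0n.
have /choice[p Hp] n := bad _ (del0 n).
pose f n := F (p n).1 (p n).2; pose f0 := F x0 y0.
have dxx x : d x x = 0 by apply/d_eq0.
have pn n : [/\ d x0 (p n).1 < r / 2, d y0 (p n).2 < r / 2,
    d x0 (p n).1 < r0 & d y0 (p n).2 < r0].
  have [] := Hp n; rewrite !lt_min => /andP[/andP[-> ->] _].
  by move=> /andP[/andP[-> ->] _].
have pinv n : d x0 (p n).1 < n.+1%:R^-1 /\ d y0 (p n).2 < n.+1%:R^-1.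
  by have [] := Hp n; rewrite !lt_min => /andP[_ ->] /andP[_ ->].
have r2r : r / 2 < r by rewrite ltr_pdivrMr// ltr_pMr// ltr1n.
set A := dball d x0 r `|` dball d y0 r in Hr.
have mA : measurable A by apply: measurableU; exact: measurable_dball.
have mCA := measurableC mA.
have if0 : nu.-integrable setT (EFin \o f0).
  by apply: integrable_product; apply: fin; rewrite dxx.
have ifn n : nu.-integrable setT (EFin \o f n).
  by apply: integrable_product; have [_ _ ? ?] := pn n; exact: fin.
have mf n : measurable_fun setT (f n) by exact: measurable_product.
have mf0 : measurable_fun setT f0 by exact: measurable_product.
have C4 : C * (e / (4 * C)) = e / 4 by field; rewrite gt_eqF.
have smallF x y : d x0 x < r -> d y0 y < r ->
    (\int[nu]_(t in A) (`|F x y t|)%:E <= (e / 4)%:E)%E.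
  move=> xx yy; apply: le_trans (HC x y A mA) _.
  by rewrite -C4 EFinM lee_wpmul2l ?lee_fin ?Hr// ltW.
pose M := C' * ((r / 2) `^ (- s1) * (r / 2) `^ (- s2)).
have r20 : 0 < r / 2 by rewrite divr_gt0.
have far x y t : d x0 x < r / 2 -> d y0 y < r / 2 -> (~` A) t ->
    [/\ r / 2 <= d x t & r / 2 <= d y t].
  move=> xx yy /not_orP[/negP + /negP]; rewrite -!leNgt => xt yt.
  have := d_triangle x0 x t; have := d_triangle y0 y t.
  by split; lra.
have bound x y t : d x0 x < r / 2 -> d y0 y < r / 2 -> (~` A) t -> `|F x y t| <= M.
  move=> xx yy At; have [xt yt] := far x y t xx yy At.
  apply: le_trans (HC' x y t _ _) _.
  - by move=> tx; move: xt; rewrite tx dxx leNgt r20.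
  - by move=> ty; move: yt; rewrite ty dxx leNgt r20.
  by rewrite ler_wpM2l ?(ltW C'0)// ler_pM ?powR_ge0// le_powRN.
have cvgf t : (~` A) t -> ((f n t)%:E @[n --> \oo] --> (f0 t)%:E)%E.
  move=> At; apply: cvg_EFin; first exact: nearW.
  have [xt yt] : r / 2 <= d x0 t /\ r / 2 <= d y0 t.
    by apply: far; rewrite ?dxx.
  have tx : t <> x0 by move=> tx; move: xt; rewrite tx dxx leNgt r20.
  have ty : t <> y0 by move=> ty; move: yt; rewrite ty dxx leNgt r20.
  apply/cvgrPdist_lt => h h0; have [del' del'0 H] := product_continuous tx ty h0.
  near=> n; rewrite distrC; have [p1 p2] := pinv n.
  have nd : n.+1%:R^-1 < del'.
    by near: n; exact: near_infty_natSinv_lt (PosNum del'0).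
  by apply: H; rewrite ?dxx// (lt_trans _ nd).
have mfE n : measurable_fun (~` A) (EFin \o f n).
  by apply: measurable_funTS; apply/measurable_EFinP.
have mf0E : measurable_fun (~` A) (EFin \o f0).
  by apply: measurable_funTS; apply/measurable_EFinP.
have iM : nu.-integrable (~` A) (cst M%:E).
  apply/integrableP; split => //=; rewrite integral_cst//.
  rewrite lte_mul_pinfty//.
  by apply: le_lt_trans nu_fin; apply: le_measure; rewrite ?inE.
have boundE n t : (~` A) t -> (`|(EFin \o f n) t| <= cst M%:E t)%E.
  by move=> At; have [? ? _ _] := pn n; rewrite /= lee_fin; exact: bound.
have [_ cvg0 _] := dominated_convergence mCA mfE mf0E (aeW nu cvgf) iM
  (aeW nu (fun t n At => boundE n t At)).
have e20 : 0 < e / 2 by rewrite divr_gt0.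
(* Every integral over the complement of [A] is at least [e / 2], although they tend to 0. *)
have : ((e / 2)%:E <= (0 : \bar R))%E; last first.
  by rewrite lee_fin leNgt e20.
apply: cvge_ge cvg0; apply: nearW => n /=.
have mD B : measurable_fun B (fun t => (`|f n t - f0 t|)%:E).
  apply: measurable_funTS; apply/measurable_EFinP; apply: measurableT_comp => //.
  exact: measurable_funB.
have mN g B : measurable_fun setT g -> measurable_fun B (fun t : T => (`|g t : R|)%:E).
  move=> mg; apply: measurable_funTS; apply/measurable_EFinP.
  exact: measurableT_comp.
have [p1 p2 _ _] := pn n; have [_ _ pe] := Hp n.
have key : (e%:E <= (e / 2)%:E + \int[nu]_(t in ~` A) (`|f n t - f0 t|)%:E)%E.
  apply: (@le_trans _ _ (\int[nu]_t (`|f n t - f0 t|)%:E)%E).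
    have : (e%:E <= `|Rintegral nu setT (f n) - Rintegral nu setT f0|%:E)%E.
      by rewrite lee_fin.
    rewrite -(RintegralB measurableT (ifn n) if0) EFin_normr_Rintegral//; last first.
      exact: (integrableB measurableT (ifn n) if0).
    move=> {}pe; apply: le_trans pe _; apply: le_abse_integral => //.
    by apply/measurable_EFinP; exact: measurable_funB.
  have [AE nonneg] : [set: T] = A `|` ~` A /\ forall t, (0 <= (`|f n t - f0 t|)%:E)%E.
    by split; [rewrite setUv|move=> t; rewrite lee_fin].
  rewrite [X in integral _ X]AE.
  apply: le_trans (ge0_le_integralU nu mA mCA (mD setT) nonneg) _.
  rewrite leeD2r//; apply: (@le_trans _ _
      (\int[nu]_(t in A) ((`|f n t|)%:E + (`|f0 t|)%:E))%E).
    apply: ge0_le_integral => //.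
    - by apply: emeasurable_funD; exact: mN.
    - by move=> t _; rewrite -EFinD lee_fin ler_normB.
  rewrite ge0_integralD//; [|exact: mN|exact: mN].
  have -> : e / 2 = e / 4 + e / 4 by field.
  rewrite EFinD; apply: leeD; apply: smallF; rewrite ?dxx//.
  - exact: lt_trans p1 r2r.
  - exact: lt_trans p2 r2r.
move: key; case: (\int[nu]_(t in _) _)%E => [v| |]//=.
- by rewrite -EFinD !lee_fin => ?; lra.
- by move=> _; rewrite leey.
Unshelve. all: by end_near. Qed.

End RealKernels.

(** * Complex kernels through four real products *)

Section ComplexKernels.
Variables (s1 s2 : R) (K1 K2 : T -> T -> R[i]).
Hypothesis s1_ge0 : 0 <= s1.
Hypothesis s2_ge0 : 0 <= s2.
Hypothesis K1_kernel : kernel_class d s1 K1.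
Hypothesis K2_kernel : kernel_class d s2 K2.

Lemma real_kernel_comp s (K : T -> T -> R[i]) (p : R[i] -> R) :
  (forall z w, p z - p w = p (z - w)) -> (forall z, `|p z| <= cabs z) ->
  kernel_class d s K -> real_kernel s (fun x y => p (K x y)).
Proof.
move=> pB p_le [Kc [C HC]]; split.
  move=> x y xy e e0; have [del del0 H] := Kc x y xy e e0.
  exists del => // x' y' xy' xx yy.
  by rewrite pB; apply: le_lt_trans (p_le _) _; exact: H.
(* Nothing forces the given [C] to be positive, hence the shift. *)
exists (`|C| + 1); first by rewrite ltr_wpDl.
move=> x y xy; apply: le_trans (p_le _) _.
have ds0 : 0 < (d x y) `^ s by rewrite powR_gt0// dist_gt0.
rewrite powRN ler_pdivlMr//; apply: le_trans (HC x y xy) _.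
by rewrite (le_trans (ler_norm C))// lerDl.
Qed.

Let K1re : real_kernel s1 (fun x y => complex.Re (K1 x y)).
Proof. exact: (real_kernel_comp (@ReB _) (@Re_le_cabs _) K1_kernel). Qed.
Let K1im : real_kernel s1 (fun x y => complex.Im (K1 x y)).
Proof. exact: (real_kernel_comp (@ImB _) (@Im_le_cabs _) K1_kernel). Qed.
Let K2re : real_kernel s2 (fun x y => complex.Re (K2 x y)).
Proof. exact: (real_kernel_comp (@ReB _) (@Re_le_cabs _) K2_kernel). Qed.
Let K2im : real_kernel s2 (fun x y => complex.Im (K2 x y)).
Proof. exact: (real_kernel_comp (@ImB _) (@Im_le_cabs _) K2_kernel). Qed.

Let J (k l : T -> T -> R) x y := Rintegral nu setT (fun t => k x t * l t y).
Let re (K : T -> T -> R[i]) x y := complex.Re (K x y).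
Let im (K : T -> T -> R[i]) x y := complex.Im (K x y).
Let K3 x y := cintegral nu setT (fun t => K1 x t * K2 t y).

Let ReK x y : (fun t => complex.Re (K1 x t * K2 t y)) =
  (fun t => re K1 x t * re K2 t y - im K1 x t * im K2 t y).
Proof. by apply/funext => t; rewrite ReM. Qed.

Let ImK x y : (fun t => complex.Im (K1 x t * K2 t y)) =
  (fun t => re K1 x t * im K2 t y + im K1 x t * re K2 t y).
Proof. by apply/funext => t; rewrite ImM. Qed.

Let prod_integrable x y : (\int[nu]_t (powerprod s1 s2 x y t)%:E < +oo)%E ->
  [/\ nu.-integrable setT (EFin \o (fun t => re K1 x t * re K2 t y)),
      nu.-integrable setT (EFin \o (fun t => im K1 x t * im K2 t y)),
      nu.-integrable setT (EFin \o (fun t => re K1 x t * im K2 t y)) &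
      nu.-integrable setT (EFin \o (fun t => im K1 x t * re K2 t y))].
Proof. by move=> fin; split; apply: (integrable_product (s1 := s1) (s2 := s2)). Qed.

Lemma cintegrable_product x y : (\int[nu]_t (powerprod s1 s2 x y t)%:E < +oo)%E ->
  cintegrable nu setT (fun t => K1 x t * K2 t y).
Proof.
move=> /prod_integrable[i1 i2 i3 i4]; split.
- have /= := integrableB measurableT i1 i2; congr integrable.
  by apply/funext => t /=; rewrite ReM.
- have /= := integrableD measurableT i3 i4; congr integrable.
  by apply/funext => t /=; rewrite ImM.
Qed.

Let K3E x y : (\int[nu]_t (powerprod s1 s2 x y t)%:E < +oo)%E ->
  K3 x y = complex.Complex (J (re K1) (re K2) x y - J (im K1) (im K2) x y)
                           (J (re K1) (im K2) x y + J (im K1) (re K2) x y).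
Proof.
move=> /prod_integrable[i1 i2 i3 i4].
rewrite /K3 /cintegral ReK ImK (RintegralB measurableT i1 i2).
by rewrite (RintegralD measurableT i3 i4).
Qed.

(** [C] is fixed before the points and [B], so each exponent regime can insert its own bound. *)
Lemma cintegral_product_le : exists2 C : R, 0 < C & forall x y B,
  (\int[nu]_t (powerprod s1 s2 x y t)%:E <= B%:E)%E -> cabs (K3 x y) <= C * B.
Proof.
have [C1 C10 H1] := Rintegral_product_le K1re K2re.
have [C2 C20 H2] := Rintegral_product_le K1im K2im.
have [C3 C30 H3] := Rintegral_product_le K1re K2im.
have [C4 C40 H4] := Rintegral_product_le K1im K2re.
exists ((C1 + C2) + (C3 + C4)); first by rewrite !addr_gt0.
move=> x y B HB; rewrite K3E; last exact: le_lt_trans HB (ltry _).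
apply: le_trans (cabs_le_ReIm _) _ => /=; rewrite !mulrDl.
apply: lerD; [apply: le_trans (ler_normB _ _) _|apply: le_trans (ler_normD _ _) _].
- by apply: lerD; [apply: H1|apply: H2].
- by apply: lerD; [apply: H3|apply: H4].
Qed.

Lemma cintegral_product_continuous x0 y0 r0 : 0 < r0 ->
  (forall x y, d x0 x < r0 -> d y0 y < r0 ->
    (\int[nu]_t (powerprod s1 s2 x y t)%:E < +oo)%E) ->
  powerprod_small_near s1 s2 x0 y0 ->
  forall e : R, 0 < e -> exists2 del : R, 0 < del & forall x y,
    d x0 x < del -> d y0 y < del -> cabs (K3 x y - K3 x0 y0) < e.
Proof.
move=> r00 fin small e e0; have e40 : 0 < e / 4 by rewrite divr_gt0.
have [d1 d10 H1] := Rintegral_product_continuous s1_ge0 s2_ge0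
  K1re K2re r00 fin small e40.
have [d2 d20 H2] := Rintegral_product_continuous s1_ge0 s2_ge0
  K1im K2im r00 fin small e40.
have [d3 d30 H3] := Rintegral_product_continuous s1_ge0 s2_ge0
  K1re K2im r00 fin small e40.
have [d4 d40 H4] := Rintegral_product_continuous s1_ge0 s2_ge0
  K1im K2re r00 fin small e40.
(* Including [r0] makes the products integrable at the moved pair, so that [K3E] applies there. *)
exists (Num.min (Num.min r0 (Num.min d1 d2)) (Num.min d3 d4)).
  by rewrite !lt_min r00 d10 d20 d30 d40.
move=> x y; rewrite !lt_min => /andP[/andP[x0r /andP[x1 x2]] /andP[x3 x4]].
move=> /andP[/andP[y0r /andP[y1 y2]] /andP[y3 y4]].
have dxx z : d z z = 0 by apply/d_eq0.
rewrite !K3E; [|by apply: fin; rewrite dxx|exact: fin].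
have h1 := H1 x y x1 y1; have h2 := H2 x y x2 y2.
have h3 := H3 x y x3 y3; have h4 := H4 x y x4 y4.
apply: le_lt_trans (cabs_le_ReIm _) _; rewrite -ReB -ImB /=.
have -> : e = (e / 4 + e / 4) + (e / 4 + e / 4) by field.
rewrite !opprD; apply: ltrD; rewrite addrACA; apply: le_lt_trans (ler_normD _ _) _.
- by apply: ltrD; [exact: h1|rewrite -opprD normrN; exact: h2].
- by apply: ltrD; [exact: h3|exact: h4].
Qed.

End ComplexKernels.

End UpperRegular.
End MetricMeasure.

(** For radii not below [r0] the finite total mass [N] bounds the measure, and
    [N <= (N / r1 ^ ups) * r ^ ups] whenever [r1 <= r]. *)
Lemma upper_ahlfors_global (R : realType) (dd : measure_display)
  (T : measurableType dd) (d : T -> T -> R) (nu : {measure set T -> \bar R})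
  (ups : R) : (forall x r, measurable (dball d x r)) -> (nu setT < +oo)%E ->
  0 < ups -> upper_ahlfors d nu ups ->
  exists2 c : R, 0 < c & forall x (r : R), 0 < r ->
    (nu (dball d x r) <= (c * r `^ ups)%:E)%E.
Proof.
move=> mball fin ups0 [r0 [r0_gt0 [c0 c0_gt0 Hc]]].
(* [r0] may be infinite, so a real radius below it serves in the constant. *)
have [r1 r1_gt0 r1r0] : exists2 r1 : R, 0 < r1 & (r1%:E < r0)%E.
  case: r0 r0_gt0 {Hc} => [r| |]//; last by exists 1; rewrite ?ltry.
  rewrite lte_fin => r_gt0; exists (r / 2); rewrite ?lte_fin ?divr_gt0//.
  by rewrite ltr_pdivrMr// ltr_pMr// ltr1n.
pose N := fine (nu setT); have N0 : 0 <= N by exact: fine_ge0.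
have p0 : 0 < r1 `^ ups by exact: powR_gt0.
have NE : (N%:E = nu setT)%E by rewrite fineK// ge0_fin_numE.
exists (c0 + N / r1 `^ ups); first by rewrite ltr_wpDr// divr_ge0// ltW.
move=> x r r_gt0; have [rr0|r0r] := ltP r%:E r0.
  apply: le_trans (Hc x r r_gt0 rr0) _.
  by rewrite lee_fin ler_wpM2r ?powR_ge0// lerDl divr_ge0// ltW.
apply: (@le_trans _ _ N%:E).
  by rewrite NE; apply: le_measure; rewrite ?inE.
have r1r : r1 <= r by rewrite -lee_fin (le_trans (ltW r1r0)).
rewrite lee_fin; apply: (@le_trans _ _ (N / r1 `^ ups * r `^ ups)); last first.
  by rewrite ler_wpM2r ?powR_ge0// lerDr ltW.
rewrite -mulrA ler_peMr// mulrC ler_pdivlMr// mul1r.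
by apply: ge0_ler_powR; rewrite ?nnegrE ?(ltW ups0) ?(ltW r_gt0) ?(ltW r1_gt0).
Qed.

(** * Assembly of the three exponent regimes *)

Theorem theorem4p2 (R : realType) (dd : measure_display) (Y : measurableType dd)
  (d : Y -> Y -> R) (nu : {measure set Y -> \bar R})
  (ups s1 s2 : R) (K1 K2 : Y -> Y -> R[i]) :
  is_metric d ->
  <<s [set A | dopen d A] >> `<=` measurable ->
  (nu setT < +oo)%E ->
  0 < ups ->
  upper_ahlfors d nu ups ->
  0 <= s1 -> s1 < ups -> 0 <= s2 -> s2 < ups ->
  (s1 + s2 = ups -> strong_upper_ahlfors d nu ups) ->
  kernel_class d s1 K1 -> kernel_class d s2 K2 ->
  let K3 := fun x y => cintegral nu setT (fun t => K1 x t * K2 t y) in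
  (ups <= s1 + s2 ->
     (forall x y, x <> y -> cintegrable nu setT (fun t => K1 x t * K2 t y)) /\
     continuous_offdiag d K3 /\
     (ups < s1 + s2 -> exists C : R, forall x y, x <> y ->
        cabs (K3 x y) * (d x y) `^ (s1 + s2 - ups) <= C) /\
     (s1 + s2 = ups -> exists C : R, forall x y, x <> y ->
        cabs (K3 x y) / (1 + `|ln (d x y)|) <= C)) /\
  (s1 + s2 < ups ->
     (forall x y, cintegrable nu setT (fun t => K1 x t * K2 t y)) /\
     continuous2 d K3 /\
     (exists C : R, forall x y,
        cabs (K3 x y) / (1 + (d x y) `^ (ups - (s1 + s2))) <= C)).
Proof.
move=> dm borel fin ups0 Hups s10 s1ups s20 s2ups _ HK1 HK2 K3.
have [c c0 Hc] := upper_ahlfors_global (measurable_dball dm borel) fin ups0 Hups.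
have [C C0 HC] := cintegral_product_le dm borel ups0 c0 Hc HK1 HK2.
have small_off := powerprod_small_offdiag dm borel ups0 c0 Hc s10 s1ups s20 s2ups.
have lty_off x y := integral_powerprod_lty dm borel ups0 c0 Hc fin
  s10 s1ups s20 s2ups (x := x) (y := y).
have int_off x y (H : (\int[nu]_t (powerprod d s1 s2 x y t)%:E < +oo)%E) :=
  cintegrable_product dm borel ups0 c0 Hc HK1 HK2 H.
have cont := cintegral_product_continuous dm borel ups0 c0 Hc fin s10 s20 HK1 HK2.
split.
- move=> sge; split; first by move=> x y xy; apply: int_off; exact: lty_off.
  split.
    move=> x y xy e e0; have dxy := dist_gt0 dm xy.
    (* Moving each point by less than half the distance keeps the pair off the diagonal, where
       integrability holds. *)
    have near_ne x' y' : d x x' < d x y / 2 -> d y y' < d x y / 2 -> x' <> y'.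
      move=> xx yy E; case: dm => _ _ dsym dtri.
      have := dtri x x' y; rewrite leNgt [ltRHS](splitr (d x y)) ltrD//.
      by rewrite E dsym.
    have r0 : 0 < d x y / 2 by rewrite divr_gt0.
    have [del del0 Hdel] := cont x y _ r0
      (fun x' y' xx yy => lty_off x' y' (near_ne x' y' xx yy)) (small_off x y xy) e e0.
    by exists del => // x' y' _ xx yy; exact: Hdel.
  split.
    move=> sgt; have [B HB] :=
      integral_powerprod_super dm borel ups0 c0 Hc s10 s1ups s20 s2ups sgt.
    exists (C * B) => x y xy; have := HC x y _ (HB x y xy).
    rewrite -[ups - (s1 + s2)]opprB powRN mulrA ler_pdivlMr//.
    by rewrite powR_gt0// (dist_gt0 dm).
  move=> seq; have [B HB] :=
    integral_powerprod_critical dm borel ups0 c0 Hc fin s10 s1ups s20 s2ups seq.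
  exists (C * B) => x y xy; have := HC x y _ (HB x y xy).
  by rewrite mulrA ler_pdivrMr// ltr_pwDl.
- move=> slt; have [B HB] := integral_powerprod_sub dm borel ups0 c0 Hc fin s10 s20 slt.
  have lty x y : (\int[nu]_t (powerprod d s1 s2 x y t)%:E < +oo)%E.
    exact: le_lt_trans (HB x y) (ltry _).
  split; first by move=> x y; exact: int_off.
  split.
    move=> x y e e0.
    exact: (cont x y 1 ltr01 (fun x' y' _ _ => lty x' y')
      (powerprod_small_sub dm borel ups0 c0 Hc x y s10 s1ups s20 s2ups slt) e e0).
  exists (C * B) => x y; have := HC x y _ (HB x y) => h.
  have p0 := powR_ge0 (d x y) (ups - (s1 + s2)).
  rewrite ler_pdivrMr ?ltr_wpDr//; apply: le_trans h _.
  (* [C * B] is nonnegative because it bounds a modulus, so multiplying it by a factor at least 1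
     only enlarges it. *)
  by rewrite ler_peMr ?lerDl// (le_trans _ (HC x y _ (HB x y)))// sqrtr_ge0.
Qed.
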